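(* Let $K^{*}_{5,5}$ be the graph obtained from the complete bipartite graph $K_{5,5}$ by removing a perfect matching. Then the obstacle number of $K^{*}_{5,5}$ is exactly $2$.
   Context: An obstacle representation of a graph $G$ consists of a finite set $P$ of points in the plane together with a finite set of closed polygonal obstacles (disjoint from $P$) such that the points of $P$ together with the vertices of the obstacles are in general position (no three collinear), and such that the visibility graph is isomorphic to $G$. The visibility graph has vertex set $P$, with $p,q\in P$ adjacent if and only if the closed segment $pq$ meets no obstacle. An obstacle representation with $h$ obstacles is an $h$-obstacle representation. The obstacle number of $G$ is the minimum number of obstacles over all obstacle representations of $G$. *)

(* Defs.v *)
From mathcomp Require Import all_boot all_order all_algebra.
From mathcomp Require Import all_classical all_reals all_analysis.
Import Order.TTheory GRing.Theory Num.Theory.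
Import numFieldNormedType.Exports.

Set Implicit Arguments.
Unset Strict Implicit.
Unset Printing Implicit Defensive.

Local Open Scope classical_set_scope.
Local Open Scope ring_scope.

Notation plane R := (R * R)%type (only parsing).

Section Plane.
Variable R : realType.
Implicit Types (p q r x : plane R) (A P : set (plane R)) (s : seq (plane R)).

Definition segment p q : set (plane R) :=
  [set (1 - t) *: p + t *: q | t in `[0, 1]].

Definition collinear p q r : Prop :=
  (q.1 - p.1) * (r.2 - p.2) = (r.1 - p.1) * (q.2 - p.2).

Definition general_position A : Prop :=
  forall p q r, A p -> A q -> A r ->
    p <> q -> p <> r -> q <> r -> ~ collinear p q r.

(* A polygon is given by the cyclic sequence of its vertices; the indices of  *)
(* vertices and edges below are taken in [0, size s).                         *)
Definition vertex s (i : nat) : plane R := nth 0 s (i %% size s).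

Definition edge s (i : nat) : set (plane R) :=
  segment (vertex s i) (vertex s i.+1).

(* Two distinct edges meet at most in a common endpoint: with pairwise        *)
(* distinct vertices, adjacent edges meet exactly in the vertex they share    *)
(* and all other pairs of edges are disjoint.                                 *)
Definition simple_polygon s : Prop :=
  [/\ (3 <= size s)%N, uniq s &
      forall i j, (i < size s)%N -> (j < size s)%N -> i <> j ->
        edge s i `&` edge s j `<=`
        [set vertex s i; vertex s i.+1] `&` [set vertex s j; vertex s j.+1]].

Definition polygon_boundary s : set (plane R) :=
  \bigcup_(i in `I_(size s)) edge s i.

(* The closed region bounded by the polygonal curve: the curve itself         *)
(* together with the bounded components of its complement.                    *)
Definition polygon_region s : set (plane R) :=
  polygon_boundary s `|`
  [set x | ~ polygon_boundary s x /\
     bounded_set (connected_component (~` polygon_boundary s) x)].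

Section Obstacles.
Variables (h : nat) (P : set (plane R)) (O : 'I_h -> seq (plane R)).

(* The obstacles form a set, so distinct indices give distinct regions.       *)
Definition obstacle_system : Prop :=
  [/\ finite_set P,
      forall i, simple_polygon (O i),
      injective (fun i => polygon_region (O i)),
      forall i, P `&` polygon_region (O i) = set0 &
      general_position (P `|` \bigcup_i [set` O i])].

Definition visibility p q : Prop :=
  [/\ P p, P q, p <> q &
      forall i, segment p q `&` polygon_region (O i) = set0].

End Obstacles.

Section Graph.
Variables (T : finType) (e : rel T).

Definition obstacle_representation h (P : set (plane R))
    (O : 'I_h -> seq (plane R)) : Prop :=
  obstacle_system P O /\
  exists2 f : T -> plane R, set_bij [set: T] P f &
    forall u v : T, e u v <-> visibility P O (f u) (f v).

Definition has_obstacle_representation (h : nat) : Prop :=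
  exists (P : set (plane R)) (O : 'I_h -> seq (plane R)),
    obstacle_representation P O.

Definition is_obstacle_number (h : nat) : Prop :=
  has_obstacle_representation h /\
  forall k, has_obstacle_representation k -> (h <= k)%N.

End Graph.
End Plane.

Definition complete_bipartite (m n : nat) : rel ('I_m + 'I_n)%type :=
  fun x y => match x, y with
             | inl _, inr _ | inr _, inl _ => true
             | _, _ => false
             end.
Arguments complete_bipartite : clear implicits.

Definition perfect_matching (T : finType) (e M : rel T) : Prop :=
  [/\ symmetric M, subrel M e & forall x, #|[pred y | M x y]| = 1%N].

Definition remove_edges (T : finType) (e M : rel T) : rel T :=
  fun x y => e x y && ~~ M x y.

(* Main.v *)
(* Lower bound. If one obstacle sufficed, its boundary G would be a connected *)
(* set that avoids all edges a_i b_j (i <> j) and meets all non-edges. Let    *)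
(* a_i, a_k lie on different sides of the line b_j b_l, with all indices      *)
(* distinct, and a_m on the side of a_i. Then G is trapped in the             *)
(* quadrilaterals a_i b_j a_k b_l and a_m b_j a_k b_l, and cannot meet        *)
(* a_i a_m, whose points are too far from the line b_j b_l. So all a_i with   *)
(* i <> j, l see b_j, b_l in the same order, and vice versa. This gives two   *)
(* linear orders on the five indices. The at most four extremes of these      *)
(* orders leave an index i which is extreme in neither order, and i can be    *)
(* chosen so that an edge from a_i and an edge from b_i cross on either side  *)
(* of the segment a_i b_i. G meets a_i b_i, so it is trapped between these    *)
(* four edges and misses a_i a_p for a suitable p.                            *)
(*                                                                            *)
(* Upper bound. In an explicit drawing with integer coordinates all edges     *)
(* avoid the boundaries of the two obstacles. The lowest point of the graph   *)
(* lies in a half-plane missed by the obstacles, so, the graph being          *)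
(* connected, all edges lie in the unbounded component of the complement of   *)
(* either boundary, and no Jordan curve theorem is needed.                    *)

Require Import Defs.
From Stdlib Require Import ZArith.
From mathcomp Require Import all_boot all_order all_algebra.
From mathcomp Require Import all_classical all_reals all_analysis.
From mathcomp Require Import ring lra zify ssrZ.
Import Order.TTheory GRing.Theory Num.Theory.
Import numFieldNormedType.Exports.

Set Implicit Arguments.
Unset Strict Implicit.
Unset Printing Implicit Defensive.

Local Open Scope classical_set_scope.
Local Open Scope ring_scope.

(** * Orientation signs, segments and the basic trapping principle *)

Section Orientation.
Variable R : realType.
Implicit Types (p q r x y z : plane R) (A G K U : set (plane R)).

(** All geometry is expressed by signs of [orient], positive when the third point lies left of the
    directed line through the first two.

    The lower bound rests on [connected_trapped]: a connected set that meets a closed region and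
    avoids its boundary stays inside. [kite_trap] and [wedge_trap] apply this to regions bounded by
    pieces of drawn edges. The first yields [no_split] and [same_side], which make [turn a b] and
    [turn b a] linear orders ([turn_trans]), seen alike from all unmatched points; [turn_matched]
    extends this to a matched point with enough points around it. A finite check on pairs of orders,
    [crossing_index_exists], supplies the configuration for [wedge_trap], and [no_drawing] follows.

    The upper bound [two_obstacles] is a computation with integer signs; [halfplane_outside] and
    [outside_edge] show that the points lie outside the obstacles. *)

Definition orient p q r : R :=
  (q.1 - p.1) * (r.2 - p.2) - (r.1 - p.1) * (q.2 - p.2).

Lemma orient_neq0 p q r : ~ collinear p q r -> orient p q r != 0.
Proof. by move=> h; apply/eqP => /subr0_eq. Qed.

Lemma orientC p q r : orient p r q = - orient p q r.
Proof. by rewrite /orient; ring. Qed.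

Lemma orient_rot p q r : orient q r p = orient p q r.
Proof. by rewrite /orient; ring. Qed.

Lemma orient_swap p q r : orient q p r = - orient p q r.
Proof. by rewrite /orient; ring. Qed.

Lemma orient_convex p q x y t :
  orient p q ((1 - t) *: x + t *: y) = (1 - t) * orient p q x + t * orient p q y.
Proof. by rewrite /orient /= /GRing.scale /=; ring. Qed.

Lemma orientxx p q : orient p q p = 0.
Proof. by rewrite /orient; ring. Qed.

Lemma orientpp p q : orient p q q = 0.
Proof. by rewrite /orient; ring. Qed.

Lemma orient_sum p q r z :
  orient p q z + orient q r z + orient r p z = orient p q r.
Proof. by rewrite /orient; ring. Qed.

(** The three-term Grassmann-Pluecker relation for four directions from [p]. *)
Lemma plucker p x y u v :
  orient p x y * orient p u v =
  orient p u y * orient p x v + orient p x u * orient p y v.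
Proof. by rewrite /orient; ring. Qed.

(** The ratio of areas [t] is the barycentric coordinate of [z] at [q]. *)
Lemma line_param p q r z : orient p q r != 0 -> orient p q z = 0 ->
  let t := orient r p z / orient p q r in z = (1 - t) *: p + t *: q.
Proof.
move=> D0 z0 t; case: z z0 @t => z1 z2 z0 t.
have tD : t * orient p q r = orient r p (z1, z2) by rewrite /t divfK.
congr pair; apply: (mulfI D0); rewrite /= ?/GRing.scale /=.
- transitivity (orient p q r * p.1 + (t * orient p q r) * (q.1 - p.1));
    last by ring.
  rewrite tD; move: z0; rewrite /orient /= => z0.
  apply/eqP; rewrite -subr_eq0; apply/eqP.
  by rewrite -[RHS](mul0r (r.1 - p.1)) -z0; ring.
- transitivity (orient p q r * p.2 + (t * orient p q r) * (q.2 - p.2));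
    last by ring.
  rewrite tD; move: z0; rewrite /orient /= => z0.
  apply/eqP; rewrite -subr_eq0; apply/eqP.
  by rewrite -[RHS](mul0r (r.2 - p.2)) -z0; ring.
Qed.

Lemma segmentP p q t : 0 <= t <= 1 -> segment p q ((1 - t) *: p + t *: q).
Proof. by move=> t01; exists t => //=; rewrite in_itv. Qed.

Lemma segment_mem p q z : segment p q z ->
  exists2 t, 0 <= t <= 1 & z = (1 - t) *: p + t *: q.
Proof. by case=> t /=; rewrite in_itv /= => t01 <-; exists t. Qed.

Lemma segmentC p q : segment p q = segment q p.
Proof.
rewrite eqEsubset; split=> z /segment_mem[t /andP[t0 t1] ->].
  have -> : (1 - t) *: p + t *: q = (1 - (1 - t)) *: q + (1 - t) *: p.
    by rewrite subKr addrC.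
  by apply: segmentP; apply/andP; split; lra.
have -> : (1 - t) *: q + t *: p = (1 - (1 - t)) *: p + (1 - t) *: q.
  by rewrite subKr addrC.
by apply: segmentP; apply/andP; split; lra.
Qed.

Lemma segment_left p q : segment p q p.
Proof. by exists 0; rewrite /= ?in_itv /= ?lexx ?ler01 // subr0 scale1r scale0r addr0. Qed.

Lemma segment_right p q : segment p q q.
Proof. by rewrite segmentC; exact: segment_left. Qed.

Lemma connected_segment p q : connected (segment p q).
Proof.
apply: connected_continuous_connected.
  exact: segment_connected.
apply: continuous_subspaceT => t.
apply: (@cvgD R (R * R)%type).
  apply: (@cvgZr_tmp R (R * R)%type).
  by apply: cvgB; [exact: cvg_cst | exact: cvg_id].
exact: (@cvgZr_tmp R (R * R)%type _ _ _ id t q cvg_id).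
Qed.

Lemma continuous_orient p q : continuous (orient p q).
Proof.
move=> z; rewrite /orient.
apply: cvgB; apply: cvgM; try exact: cvg_cst.
  by apply: cvgB; [exact: cvg_snd | exact: cvg_cst].
by apply: cvgB; [exact: cvg_fst | exact: cvg_cst].
Qed.

Lemma open_left p q : open [set z | 0 < orient p q z].
Proof.
apply: (@open_comp _ _ (orient p q) [set t | 0 < t]); last exact: open_gt.
by move=> z _; exact: continuous_orient.
Qed.

Lemma closed_left p q : closed [set z | 0 <= orient p q z].
Proof.
apply: (@closed_comp _ _ (orient p q) [set t | 0 <= t]); last exact: closed_ge.
by move=> z _; exact: continuous_orient.
Qed.

(** The part of [G] in [K] is closed in [G]; it equals the part in [U], so it is also open in
    [G]. *)
Lemma connected_trapped G K U : connected G -> closed K -> open U ->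
  U `<=` K -> G `&` K `<=` U -> G `&` K !=set0 -> G `<=` K.
Proof.
move=> Gc Kc Uo UK GKU GK0.
have GKE : G `&` K = G.
  apply: Gc => //; last by exists K.
  exists U => //; rewrite eqEsubset; split=> z [Gz ?]; split=> //.
    exact: GKU.
  exact: UK.
by rewrite -GKE => z [].
Qed.

(** The line [r s] through [p] bounds the parameter of [z] below by 0; the line [x y], separating
    [p] from [q], bounds it above by 1. *)
Lemma on_segment (w r s x y p q z : plane R) :
  orient p q w != 0 -> orient p q z = 0 ->
  orient r s p = 0 -> 0 < orient r s q -> 0 <= orient r s z ->
  0 < orient x y p -> orient x y q < 0 -> 0 <= orient x y z ->
  segment p q z.
Proof.
move=> D0 z0 rp rq rz xp xq xz.
have /= zE := line_param D0 z0; set t := _ / _ in zE.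
have t0 : 0 <= t.
  by move: rz; rewrite zE orient_convex rp mulr0 add0r pmulr_lge0.
rewrite zE; apply: segmentP; rewrite t0 /=.
by move: xz; rewrite zE orient_convex; nra.
Qed.

End Orientation.

(** * Regions in which drawn edges trap a connected set *)

Section Trapping.
Variable R : realType.
Implicit Types (p q z : plane R) (G : set (plane R)).

(* The union of the two triangles on the common side [q q'] is closed, and    *)
(* only points of the four avoided segments keep it from being open, so it    *)
(* contains [G].                                                              *)
Lemma kite_trap p p' q q' G : connected G ->
  0 < orient q q' p -> orient q q' p' < 0 ->
  G `&` segment p q = set0 -> G `&` segment p q' = set0 ->
  G `&` segment p' q = set0 -> G `&` segment p' q' = set0 ->
  G `&` segment q q' !=set0 ->
  forall z, G z -> orient q q' z < orient q q' p.
Proof.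
move=> Gc hp hp' Gpq Gpq' Gp'q Gp'q' G0.
have avoid s t z : G `&` segment s t = set0 -> segment s t z -> ~ G z.
  by move=> E sz Gz; have : (G `&` segment s t) z by []; rewrite E.
pose K := [set z | 0 <= orient q q' z /\ 0 <= orient p q z /\ 0 <= orient q' p z]
  `|` [set z | 0 <= orient q' q z /\ 0 <= orient q p' z /\ 0 <= orient p' q' z].
(* The third piece, the intersection of the angles at [p] and [p'], adds the interior points of the
   common side, which lie in neither open triangle. *)
pose U := [set z | 0 < orient q q' z /\ 0 < orient p q z /\ 0 < orient q' p z]
  `|` [set z | 0 < orient q' q z /\ 0 < orient q p' z /\ 0 < orient p' q' z]
  `|` [set z | (0 < orient p q z /\ 0 < orient q' p z) /\
               0 < orient q p' z /\ 0 < orient p' q' z].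
have flip z : orient q' q z = - orient q q' z by exact: orient_swap.
have hE z : orient q q' z = - orient q' q z by rewrite flip opprK.
have hp2 : 0 < orient q' q p' by rewrite flip oppr_gt0.
have Ptop z : 0 <= orient q q' z -> orient p q z = 0 -> 0 <= orient q' p z ->
    segment p q z.
  move=> h1 h2 h3; have D : orient p q q' = orient q q' p by rewrite /orient; ring.
  have D0 : orient p q q' != 0 by rewrite D gt_eqF.
  have /= -> := line_param D0 h2; apply: segmentP.
  have := orient_sum p q q' z; rewrite D h2 add0r => S.
  rewrite ?D divr_ge0 ?(ltW hp) //= ler_pdivrMr // mul1r; lra.
have Ptop' z : 0 <= orient q q' z -> 0 <= orient p q z -> orient q' p z = 0 ->
    segment p q' z.
  move=> h1 h2 h3; have D : orient q' p q = orient q q' p by rewrite /orient; ring.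
  have D0 : orient q' p q != 0 by rewrite D gt_eqF.
  rewrite segmentC; have /= -> := line_param D0 h3; apply: segmentP.
  have := orient_sum p q q' z; have D' : orient p q q' = orient q q' p by rewrite /orient; ring.
  rewrite D' h3 addr0 => S.
  rewrite ?D divr_ge0 ?(ltW hp) //= ler_pdivrMr // mul1r; lra.
have Pbot z : 0 <= orient q' q z -> orient q p' z = 0 -> 0 <= orient p' q' z ->
    segment p' q z.
  move=> h1 h2 h3; have D : orient q p' q' = orient q' q p' by rewrite /orient; ring.
  have D0 : orient q p' q' != 0 by rewrite D gt_eqF.
  rewrite segmentC; have /= -> := line_param D0 h2; apply: segmentP.
  have := orient_sum q p' q' z; rewrite D h2 add0r => S.
  rewrite ?D divr_ge0 ?(ltW hp2) //= ler_pdivrMr // mul1r; lra.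
have Pbot' z : 0 <= orient q' q z -> 0 <= orient q p' z -> orient p' q' z = 0 ->
    segment p' q' z.
  move=> h1 h2 h3; have D : orient p' q' q = orient q' q p' by rewrite /orient; ring.
  have D0 : orient p' q' q != 0 by rewrite D gt_eqF.
  have /= -> := line_param D0 h3; apply: segmentP.
  have := orient_sum p' q' q z; rewrite D h3 add0r => S.
  rewrite ?D divr_ge0 ?(ltW hp2) //= ler_pdivrMr // mul1r; lra.
have Kstrict z : K z -> G z -> U z.
  move=> Kz Gz.
  have n1 := fun h1 h2 h3 => avoid _ _ z Gpq (Ptop z h1 h2 h3) Gz.
  have n2 := fun h1 h2 h3 => avoid _ _ z Gpq' (Ptop' z h1 h2 h3) Gz.
  have n3 := fun h1 h2 h3 => avoid _ _ z Gp'q (Pbot z h1 h2 h3) Gz.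
  have n4 := fun h1 h2 h3 => avoid _ _ z Gp'q' (Pbot' z h1 h2 h3) Gz.
  (* On the common side, where [orient q q' z] vanishes, these identities carry signs from one
     triangle to the other. *)
  have i1 : orient p q z * orient q' q p' = orient q p' z * orient q q' p
      + orient q q' z * orient q p p' by rewrite /orient; ring.
  have i2 : orient q' p z * orient q' q p' = orient p' q' z * orient q q' p
      + orient q q' z * orient q' p' p by rewrite /orient; ring.
  case: Kz => /= -[h0 [h1 h2]].
    have f1 : 0 < orient p q z.
      by rewrite lt_neqAle h1 andbT; apply/eqP => E; apply: n1.
    have f2 : 0 < orient q' p z.
      by rewrite lt_neqAle h2 andbT; apply/eqP => E; apply: n2.
    have [E|h0'] := eqVneq (orient q q' z) 0; last first.
      by left; left; split; rewrite // lt_neqAle eq_sym h0'.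
    right; do 2 split => //.
      by rewrite -(pmulr_lgt0 _ hp); move: i1; rewrite E mul0r addr0 => <-;
        rewrite mulr_gt0.
    by rewrite -(pmulr_lgt0 _ hp); move: i2; rewrite E mul0r addr0 => <-;
        rewrite mulr_gt0.
  have f1 : 0 < orient q p' z.
    by rewrite lt_neqAle h1 andbT; apply/eqP => E; apply: n3.
  have f2 : 0 < orient p' q' z.
    by rewrite lt_neqAle h2 andbT; apply/eqP => E; apply: n4.
  have [E|h0'] := eqVneq (orient q' q z) 0; last first.
    by left; right; split; rewrite // lt_neqAle eq_sym h0'.
  have E' : orient q q' z = 0 by rewrite hE E oppr0.
  right; split; split=> //.
    by rewrite -(pmulr_lgt0 _ hp2) i1 E' mul0r addr0 mulr_gt0.
  by rewrite -(pmulr_lgt0 _ hp2) i2 E' mul0r addr0 mulr_gt0.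
have UK : U `<=` K.
  move=> z [[[h0 [h1 h2]]|[h0 [h1 h2]]]|[[h1 h2] [h3 h4]]].
  - by left; split; [|split]; apply: ltW.
  - by right; split; [|split]; apply: ltW.
  - have [h0|h0] := leP 0 (orient q q' z).
      by left; split=> //; split; apply: ltW.
    by right; split; [rewrite flip; lra | split; apply: ltW].
have GK : G `<=` K.
  apply: (@connected_trapped _ G K U) => //.
  - apply: closedU; do 2 (apply: closedI; first exact: closed_left);
      exact: closed_left.
  - apply: openU; [apply: openU|];
      repeat first [exact: open_left | apply: openI].
  - by move=> z [Gz Kz]; apply: Kstrict.
  - case: G0 => z [Gz /segment_mem[t /andP[t0 t1] zE]]; exists z; split=> //.
    have D1 : orient p q q' = orient q q' p by rewrite /orient; ring.
    have D2 : orient q' p q = orient q q' p by rewrite /orient; ring.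
    left; rewrite /= zE !orient_convex orientxx !orientpp D1 D2.
    rewrite orientxx !mulr0 add0r addr0; split=> //.
    by split; nra.
have sumE : orient p q q' = orient q q' p by rewrite /orient; ring.
move=> z Gz; have [[[h0 [h1 h2]]|[h0 [h1 h2]]]|[[h1 h2] _]] := Kstrict z (GK z Gz) Gz.
- have := orient_sum p q q' z; rewrite sumE; lra.
- by move: h0; rewrite flip; lra.
- have := orient_sum p q q' z; rewrite sumE; lra.
Qed.

(* [G] cannot leave the intersection of the two wedges at [p] and [q], whose  *)
(* boundary is covered by initial pieces of the four avoided segments.        *)
Lemma wedge_trap p q u v m n G : connected G ->
  G `&` segment p u = set0 -> G `&` segment p n = set0 ->
  G `&` segment q v = set0 -> G `&` segment q m = set0 ->
  G `&` segment p q !=set0 ->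
  0 < orient p q u -> 0 < orient p q v ->
  orient p q n < 0 -> orient p q m < 0 ->
  0 < orient p n u -> 0 < orient q v m ->
  0 < orient p u v -> orient q v u < 0 ->
  0 < orient q m n -> orient p n m < 0 ->
  forall z, G z -> 0 < orient p n z /\ orient p u z < 0.
Proof.
move=> Gc Gpu Gpn Gqv Gqm G0 hu hv hn hm pnu qvm puv qvu qmn pnm.
have avoid s t z : G `&` segment s t = set0 -> segment s t z -> ~ G z.
  by move=> E sz Gz; have : (G `&` segment s t) z by []; rewrite E.
pose K := [set z | 0 <= orient p n z] `&` [set z | 0 <= orient u p z]
  `&` ([set z | 0 <= orient q v z] `&` [set z | 0 <= orient m q z]).
pose U := [set z | 0 < orient p n z] `&` [set z | 0 < orient u p z]
  `&` ([set z | 0 < orient q v z] `&` [set z | 0 < orient m q z]).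
have qvp : 0 < orient q v p by move: hv; rewrite -orient_rot.
have mqp : 0 < orient m q p.
  have -> : orient m q p = - orient p q m by rewrite /orient; ring.
  by rewrite oppr_gt0.
have pnq : 0 < orient p n q by rewrite orientC oppr_gt0.
have upq : 0 < orient u p q.
  (suff -> : orient u p q = orient p q u by []); rewrite /orient; ring.
have strict z : K z -> G z -> U z.
  move=> [[/= h1 h2] [/= h3 h4]] Gz.
  (* Each bounding ray leaves the other wedge before its avoided segment ends: the line [m q]
     separates [n] from [p], the line [q v] separates [u] from [p], and likewise for the rays from
     [q]. *)
  split; split; rewrite /= lt_neqAle ?(h1, h2, h3, h4) andbT eq_sym; apply/eqP => E.
  - apply: (avoid _ _ z Gpn) => //.
    apply: (@on_segment R u u p m q) => //; rewrite ?(orientpp, orientxx) //.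
    + by rewrite gt_eqF.
    + by have -> : orient u p n = orient p n u by rewrite /orient; ring.
    + by rewrite orient_swap oppr_lt0.
  - apply: (avoid _ _ z Gpu) => //.
    apply: (@on_segment R n p n q v) => //; rewrite ?(orientpp, orientxx) //.
    + by rewrite orientC oppr_eq0 gt_eqF.
    + by apply/eqP; rewrite -oppr_eq0 -orient_swap E.
  - apply: (avoid _ _ z Gqv) => //.
    apply: (@on_segment R m m q u p) => //; rewrite ?(orientpp, orientxx) //.
    + by rewrite gt_eqF.
    + by have -> : orient m q v = orient q v m by rewrite /orient; ring.
    + by rewrite orient_swap oppr_lt0.
  - apply: (avoid _ _ z Gqm) => //.
    apply: (@on_segment R v q v p n) => //; rewrite ?(orientpp, orientxx) //.
    + by rewrite orientC oppr_eq0 gt_eqF.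
    + by apply/eqP; rewrite -oppr_eq0 -orient_swap E.
have GK : G `<=` K.
  apply: (@connected_trapped _ G K U) => //.
  - by apply: closedI; apply: closedI; exact: closed_left.
  - by apply: openI; apply: openI; exact: open_left.
  - by move=> z [[/= h1 h2] [/= h3 h4]]; split; split; apply: ltW.
  - by move=> z [Gz Kz]; apply: strict.
  - case: G0 => z [Gz /segment_mem[t /andP[t0 t1] zE]]; exists z; split=> //.
    by split; split; rewrite /= zE orient_convex ?(orientpp, orientxx); nra.
move=> z Gz; have [[/= h1 h2] _] := strict z (GK z Gz) Gz.
by split=> //; rewrite orient_swap oppr_lt0.
Qed.

End Trapping.

(** * One-obstacle drawings and the two orders they induce *)

Section Drawing.
Variable R : realType.
Implicit Types (a b : 'I_5 -> plane R) (G : set (plane R)) (i j k l m n : 'I_5).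

(** The situation to refute: [G] is the boundary of a single obstacle, the points are numbered so
    that [a i] and [b i] are matched, and general position is kept for mixed triples. *)
Record drawing a b G : Prop := Drawing {
  drawing_connected : connected G;
  drawing_aab : forall i j k, i != j -> orient (a i) (a j) (b k) != 0;
  drawing_abb : forall i j k, j != k -> orient (a i) (b j) (b k) != 0;
  drawing_edge : forall i j, i != j -> G `&` segment (a i) (b j) = set0;
  drawing_aa : forall i j, i != j -> G `&` segment (a i) (a j) !=set0;
  drawing_bb : forall i j, i != j -> G `&` segment (b i) (b j) !=set0;
  drawing_ab : forall i, G `&` segment (a i) (b i) !=set0 }.

Lemma drawing_sym a b G : drawing a b G -> drawing b a G.
Proof.
case=> c aab abb e aa bb ab; split=> // [i j k ij|i j k jk|i j ij|i].
- by rewrite -orient_rot orient_rot orient_rot; apply: abb.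
- by rewrite -orient_rot; apply: aab.
- by rewrite segmentC; apply: e; rewrite eq_sym.
- by rewrite segmentC.
Qed.

(** By [kite_trap] every point of [G] is closer to the line [b j b l] than [a i] and than [a m], but
    a point of the segment [a i a m] cannot be closer than both. *)
Lemma no_split a b G i k m j l : drawing a b G ->
  uniq [:: i; k; m; j; l] ->
  0 < orient (b j) (b l) (a i) -> 0 < orient (b j) (b l) (a m) ->
  orient (b j) (b l) (a k) < 0 -> False.
Proof.
case=> c aab abb e aa bb ab.
rewrite /= !inE !negb_or -!andbA => /and5P[ik im ij il /and5P[km kj kl mj /and3P[ml jl _]]].
move=> hi hm hk.
have [z [Gz /segment_mem[t /andP[t0 t1] zE]]] := aa _ _ im.
have zi := kite_trap c hi hk (e _ _ ij) (e _ _ il) (e _ _ kj) (e _ _ kl) (bb _ _ jl) Gz.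
have zm := kite_trap c hm hk (e _ _ mj) (e _ _ ml) (e _ _ kj) (e _ _ kl) (bb _ _ jl) Gz.
move: zi zm; rewrite zE orient_convex.
set A := orient _ _ (a i); set B := orient _ _ (a m) => zi zm.
have [AB|AB] := leP A B; nra.
Qed.

Lemma fresh (s : seq 'I_5) : (size s < 5)%N -> exists i, i \notin s.
Proof.
move=> s5; have /card_gt0P[i] : (0 < #|[predC s]|)%N.
  rewrite -(ltn_add2l #|s|) addn0 cardC card_ord.
  exact: leq_ltn_trans (card_size s) s5.
by rewrite inE => ?; exists i.
Qed.

Lemma same_side a b G i k j l : drawing a b G -> j != l ->
  i \notin [:: j; l] -> k \notin [:: j; l] ->
  (0 < orient (a i) (b j) (b l)) = (0 < orient (a k) (b j) (b l)).
Proof.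
move=> D jl; have [->//|ik] := eqVneq i k.
rewrite !inE !negb_or => /andP[ij il] /andP[kj kl].
have [m] := @fresh [:: i; k; j; l] isT.
rewrite !inE !negb_or => /and4P[mi mk mj ml].
have rot x : orient (a x) (b j) (b l) = orient (b j) (b l) (a x).
  by rewrite -orient_rot.
have n0 x : orient (b j) (b l) (a x) != 0.
  by rewrite -rot; apply: drawing_abb D _ _ _ jl.
suff H x y : x != y -> m != x -> m != y -> x != j -> x != l -> y != j -> y != l ->
    0 < orient (b j) (b l) (a x) -> orient (b j) (b l) (a y) < 0 -> False.
  rewrite !rot; apply/idP/idP => h; rewrite ltNge le_eqVlt (negPf (n0 _)) /=;
    apply/negP => h'.
    exact: (H i k ik mi mk ij il kj kl h h').
  by apply: (H k i _ mk mi kj kl ij il h h'); rewrite eq_sym.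
move=> xy mx my xj xl yj yl hx hy.
have [hm|hm|/eqP] := ltgtP 0 (orient (b j) (b l) (a m)); last first.
- by rewrite eq_sym (negPf (n0 m)).
(* Here [a m] is on the side of [a y]; exchanging [j] and [l] reverses all signs. *)
- apply: (@no_split a b G y x m l j D); last 3 first.
  + by rewrite orient_swap oppr_gt0.
  + by rewrite orient_swap oppr_gt0.
  + by rewrite orient_swap oppr_lt0.
  by rewrite /= !inE !negb_or -!andbA /= (eq_sym y x) (eq_sym y m) (eq_sym x m)
     (eq_sym l j) xy mx my xj xl yj yl mj ml jl.
apply: (@no_split a b G x y m j l D) => //.
by rewrite /= !inE !negb_or -!andbA /= (eq_sym y m) (eq_sym x m)
     xy mx my xj xl yj yl mj ml jl.
Qed.

(* In a drawing the choice of [i] does not matter. *)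
Definition turn a b : rel 'I_5 :=
  fun j l => [exists i, (i \notin [:: j; l]) && (0 < orient (a i) (b j) (b l))].

Lemma turnE a b G i j l : drawing a b G -> j != l -> i \notin [:: j; l] ->
  (0 < orient (a i) (b j) (b l)) = turn a b j l.
Proof.
move=> D jl ijl; apply/idP/existsP => [h|[k /andP[kjl h]]].
  by exists i; rewrite ijl.
by rewrite (same_side D jl ijl kjl).
Qed.

Lemma turnNE a b G i j l : drawing a b G -> j != l -> i \notin [:: j; l] ->
  (orient (a i) (b j) (b l) < 0) = ~~ turn a b j l.
Proof.
move=> D jl ijl; rewrite -(turnE D jl ijl) -leNgt le_eqVlt.
by rewrite (negPf (drawing_abb D _ jl)).
Qed.

Lemma turn_irr a b j : turn a b j j = false.
Proof. by apply/existsP => -[i]; rewrite orientpp ltxx andbF. Qed.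

Lemma turn_asym a b G j l : drawing a b G -> j != l ->
  turn a b l j = ~~ turn a b j l.
Proof.
move=> D jl; have [i ijl] := @fresh [:: j; l] isT.
have ilj : i \notin [:: l; j] by move: ijl; rewrite !inE !negb_or andbC.
by rewrite -(turnNE D jl ijl) -(turnE D _ ilj) 1?eq_sym // orientC oppr_gt0.
Qed.

(** In a cycle, [a i] would lie inside the triangle [b j b l b m], so every line through it would
    separate the vertices; but by [same_side] for the exchanged colours the line [a i a k] does
    not. *)
Lemma turn_trans a b G : drawing a b G -> transitive (turn a b).
Proof.
move=> D l j m; have [->|jl] := eqVneq j l; first by rewrite turn_irr.
have [->|lm] := eqVneq l m; first by rewrite turn_irr.
have [<-|jm] := eqVneq j m.
  by rewrite (turn_asym D jl) => ->.
move=> hjl hlm; apply: contraT => hjm.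
have [i] := @fresh [:: j; l; m] isT.
rewrite !inE !negb_or => /and3P[ij il im].
have [k] := @fresh [:: i; j; l; m] isT.
rewrite !inE !negb_or => /and4P[ki kj kl km].
have P1 : 0 < orient (a i) (b j) (b l).
  by rewrite (turnE D) // !inE negb_or ij.
have P2 : 0 < orient (a i) (b l) (b m).
  by rewrite (turnE D) // !inE negb_or il.
have P3 : 0 < orient (a i) (b m) (b j).
  by rewrite (turnE D) 1?eq_sym // ?(turn_asym D jm) // !inE negb_or im.
have sgnE x y : x != y -> x != i -> x != k -> y != i -> y != k ->
    (0 < orient (a i) (a k) (b x)) = (0 < orient (a i) (a k) (b y)).
  move=> xy xi xk yi yk.
  have r z : orient (a i) (a k) (b z) = orient (b z) (a i) (a k).
    by rewrite -orient_rot orient_rot -orient_rot orient_rot orient_rot.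
  by rewrite !r; apply: same_side (drawing_sym D) _ _ _;
    rewrite ?(eq_sym i k) // !inE negb_or ?xi ?xk ?yi ?yk.
have nz x : orient (a i) (a k) (b x) != 0.
  by apply: drawing_aab D _ _ _ _; rewrite eq_sym.
have := sgnE j l jl; rewrite !(eq_sym j) !(eq_sym l) ij il kj kl => /(_ isT isT isT isT) E1.
have := sgnE j m jm; rewrite !(eq_sym j) !(eq_sym m) ij im kj km => /(_ isT isT isT isT) E2.
have S : orient (a i) (b l) (b m) * orient (a i) (a k) (b j)
  + orient (a i) (b m) (b j) * orient (a i) (a k) (b l)
  + orient (a i) (b j) (b l) * orient (a i) (a k) (b m) = 0.
  by rewrite /orient; ring.
move: (nz j) (nz l) (nz m) E1 E2; rewrite /=.
by case: ltgtP => // hj; case: ltgtP => // hl; case: ltgtP => // hm _ _ _ _ _; nra.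
Qed.

(** Seen from [b l], the point [a i] lies between [a m] and [a n], so by [plucker] its sign is a
    positive combination of their equal signs. *)
Lemma turn_matched a b G i l m n : drawing a b G -> i != l ->
  m != l -> n != l -> turn b a m i -> turn b a i n ->
  (0 < orient (a i) (b i) (b l)) = turn a b i l.
Proof.
move=> D il ml nl tmi tin; have D' := drawing_sym D.
have mi : m != i by apply: contraTneq tmi => ->; rewrite turn_irr.
have ni : n != i by apply: contraTneq tin => ->; rewrite turn_irr.
have tmn := turn_trans D' tmi tin.
have mn : m != n by apply: contraTneq tmn => ->; rewrite turn_irr.
have P1 : 0 < orient (b l) (a m) (a i).
  by rewrite (turnE D') // !inE negb_or !(eq_sym l) ml il.
have P2 : 0 < orient (b l) (a i) (a n).
  by rewrite (turnE D') // 1?eq_sym // !inE negb_or !(eq_sym l) nl il.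
have P3 : 0 < orient (b l) (a m) (a n).
  by rewrite (turnE D') // !inE negb_or !(eq_sym l) nl ml.
have im : m \notin [:: i; l] by rewrite !inE negb_or mi.
have in' : n \notin [:: i; l] by rewrite !inE negb_or ni.
have E := plucker (b l) (a m) (a n) (a i) (b i).
have r x : orient (b l) (a x) (b i) = orient (a x) (b i) (b l).
  by rewrite /orient; ring.
move: E; rewrite !r => E.
apply/idP/idP => h; last first.
  have := h; rewrite -(turnE D il im) => hm.
  have := h; rewrite -(turnE D il in') => hn; nra.
apply: contraT => h'.
have := h'; rewrite -(turnNE D il im) => hm.
have := h'; rewrite -(turnNE D il in') => hn; nra.
Qed.

End Drawing.

(** * Combinatorics of two linear orders on five indices *)

Section TwoOrders.

Definition strict_total (T : eqType) (r : rel T) : Prop :=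
  [/\ irreflexive r, transitive r & forall x y, x != y -> r x y || r y x].

Lemma strict_total_index (T : finType) (r : rel T) : strict_total r ->
  exists2 q : seq T, perm_eq q (enum T) &
    forall x y, r x y = (index x q < index y q)%N.
Proof.
case=> irr tr tot; pose r' x y := (x == y) || r x y.
have r'tot : total r'.
  move=> x y; rewrite /r'; case: eqVneq => //= xy.
  exact: tot.
have r'tr : transitive r'.
  move=> y x z /orP[/eqP->//|xy] /orP[/eqP<-|yz]; rewrite /r' ?xy ?orbT //.
  by rewrite (tr _ _ _ xy yz) orbT.
exists (sort r' (enum T)); first by rewrite perm_sort.
have sq : sorted r' (sort r' (enum T)) by apply: sort_sorted.
have mq x : x \in sort r' (enum T) by rewrite mem_sort mem_enum.
move=> x y; have lt_r u v :
    (index u (sort r' (enum T)) < index v (sort r' (enum T)))%N -> r u v.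
  move=> uv; have /orP[/eqP E|//] := sorted_ltn_index r'tr sq _ _ (mq _) (mq _) uv.
  by move: uv; rewrite E ltnn.
apply/idP/idP => [xy|]; last exact: lt_r.
rewrite ltnNge leq_eqVlt; apply/negP => /orP[/eqP E|/lt_r yx].
  have := nth_index x (mq y); rewrite E nth_index // => E'.
  by move: xy; rewrite E' irr.
by have := tr _ _ _ xy yx; rewrite irr.
Qed.

(** The betweenness hypothesis of [turn_matched], with [z] as its [l]. *)
Definition straddled (T : eqType) (r : rel T) (i z : T) : Prop :=
  exists x y, [/\ r x i, r i y, x != z & y != z].

(* [i] lies between [l] and [n] for [r1] and between [k] and [m] for [r2],    *)
(* with enough further elements around it for [turn_matched] to apply.        *)
Definition crossing_index (T : eqType) (r1 r2 : rel T) (i k l m n : T) : Prop :=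
  [/\ [/\ r1 i l, r1 n i, r2 k i & r2 i m], k != l, m != n,
      straddled r2 i l /\ straddled r2 i n &
      straddled r1 i k /\ straddled r1 i m].

Let straddledb (r : rel nat) (i z : nat) : bool :=
  has (fun x => has (fun y => (x != z) && (y != z))
    [seq y <- iota 0 5 | r i y]) [seq x <- iota 0 5 | r x i].

Let crossing_indexb (r : rel nat) : bool :=
  has (fun i => has (fun k => has (fun l => has (fun m => has (fun n =>
    [&& k != l, m != n, straddledb r i l, straddledb r i n,
        straddledb ltn i k & straddledb ltn i m])
    (iota 0 i)) [seq m <- iota 0 5 | r i m]) (iota i.+1 (4 - i)))
    [seq k <- iota 0 5 | r k i]) (iota 0 5).

(** With the first order normalised to the natural one, the second is one of 120 permutations. *)
Let all_crossing : all
  (fun q => crossing_indexb (fun x y => index x q < index y q)%N)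
  (permutations (iota 0 5)).
Proof. by vm_compute. Qed.

Let straddledP (r : rel 'I_5) (rn : rel nat) (i z : 'I_5) :
  (forall x y : 'I_5, r x y = rn x y) -> straddledb rn i z -> straddled r i z.
Proof.
move=> rE /hasP[x]; rewrite mem_filter mem_iota => /andP[rxi x5].
move=> /hasP[y]; rewrite mem_filter mem_iota => /andP[riy y5] /andP[xz yz].
by exists (@Ordinal 5 x x5), (@Ordinal 5 y y5); rewrite !rE; split.
Qed.

Let crossing_index_std (t : rel 'I_5) : strict_total t ->
  exists i k l m n, crossing_index (fun x y : 'I_5 => (x < y)%N) t i k l m n.
Proof.
move=> /strict_total_index[q qe tE].
have tE' (x y : 'I_5) :
    t x y = (index (val x) (map val q) < index (val y) (map val q))%N.
  by rewrite tE !(index_map val_inj).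
have : map val q \in permutations (iota 0 5).
  by rewrite mem_permutations -val_enum_ord perm_map.
move=> /(allP all_crossing) /hasP[i]; rewrite mem_iota => i5.
move=> /hasP[k]; rewrite mem_filter mem_iota => /andP[rki k5].
move=> /hasP[l]; rewrite mem_iota => /andP[il l5].
have {}l5 : (l < 5)%N by move: l5; rewrite addSn subnKC // -ltnS.
move=> /hasP[m]; rewrite mem_filter mem_iota => /andP[rim m5].
move=> /hasP[n]; rewrite mem_iota add0n => ni.
have n5 : (n < 5)%N by apply: ltn_trans ni i5.
move=> /and5P[kl mn sl sn /andP[sk sm]].
exists (@Ordinal 5 i i5), (@Ordinal 5 k k5), (Ordinal l5), (@Ordinal 5 m m5), (Ordinal n5).
split; [by rewrite !tE' | exact: kl | exact: mn | |].
  by split; apply: (@straddledP t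
    (fun x y => index x (map val q) < index y (map val q))%N).
by split; apply: (@straddledP _ ltn).
Qed.

(** Listing the indices along [s] reduces to the normalised case. *)
Lemma crossing_index_exists (s t : rel 'I_5) : strict_total s -> strict_total t ->
  exists i k l m n, crossing_index s t i k l m n.
Proof.
move=> sst [tirr ttr ttot]; have [p pe sE] := strict_total_index sst.
have p5 : size p = 5 by rewrite (perm_size pe) size_enum_ord.
have pu : uniq p by rewrite (perm_uniq pe) enum_uniq.
pose g (x : 'I_5) := nth ord0 p x.
have gE x : index (g x) p = x by rewrite index_uniq // p5.
have g_inj : injective g by move=> x y /(congr1 (index^~ p)); rewrite !gE => /val_inj.
have sg x y : s (g x) (g y) = (x < y)%N by rewrite sE !gE.
have [|i [k [l [m [n [[il ni ki im] kl mn [Sl Sn] [Sk Sm]]]]]]] :=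
    @crossing_index_std (fun x y => t (g x) (g y)).
  split=> [x|y x z|x y xy]; [exact: tirr | exact: ttr | apply: ttot].
  by rewrite (inj_eq g_inj).
have Ss z : straddled (fun x y : 'I_5 => (x < y)%N) i z -> straddled s (g i) (g z).
  by case=> x [y [? ? ? ?]]; exists (g x), (g y); rewrite !sg !(inj_eq g_inj).
have St z : straddled (fun x y : 'I_5 => t (g x) (g y)) i z ->
    straddled t (g i) (g z).
  by case=> x [y [? ? ? ?]]; exists (g x), (g y); rewrite !(inj_eq g_inj).
exists (g i), (g k), (g l), (g m), (g n).
split; [by rewrite !sg | by rewrite (inj_eq g_inj) | by rewrite (inj_eq g_inj) | |].
  by split; apply: St.
by split; apply: Ss.
Qed.

End TwoOrders.

(** * The contradiction for one obstacle *)

Lemma turn_strict_total (R : realType) (a b : 'I_5 -> plane R) G :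
  drawing a b G -> strict_total (turn a b).
Proof.
move=> D; split=> [x||x y xy]; [exact: turn_irr | exact: turn_trans D |].
by rewrite (turn_asym D xy) orbN.
Qed.

(** [wedge_trap] confines [G] to the angle at [a i] between [b n] and [b l]. As [G] meets [a i a p],
    the point [a p] is in that angle, so the line [a i a p] separates [b n] from [b l], against
    [same_side]. *)
Lemma no_drawing (R : realType) (a b : 'I_5 -> plane R) G : ~ drawing a b G.
Proof.
move=> D; have D' := drawing_sym D.
have [i [k [l [m [n [[il ni ki im] kl mn [Sl Sn] [Sk Sm]]]]]]] :=
  crossing_index_exists (turn_strict_total D) (turn_strict_total D').
have neq (r : rel 'I_5) x y : strict_total r -> r x y -> x != y.
  by case=> irr _ _ xy; apply: contraTneq xy => ->; rewrite irr.
have Ta := turn_strict_total D; have Tb := turn_strict_total D'.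
have il' := neq _ _ _ Ta il; have ni' := neq _ _ _ Ta ni.
have ki' := neq _ _ _ Tb ki; have im' := neq _ _ _ Tb im.
have nl := turn_trans D ni il; have nl' := neq _ _ _ Ta nl.
have km := turn_trans D' ki im; have km' := neq _ _ _ Tb km.
have in' : i != n by rewrite eq_sym.
have ik' : i != k by rewrite eq_sym.
have nsE x y : x != y -> turn a b x y -> turn a b y x = false.
  by move=> xy h; rewrite (turn_asym D xy) h.
have ntE x y : x != y -> turn b a x y -> turn b a y x = false.
  by move=> xy h; rewrite (turn_asym D' xy) h.
have lt0 x y z : y != z -> ~~ (0 < orient (a x) (b y) (b z)) ->
    orient (a x) (b y) (b z) < 0.
  by move=> yz; rewrite -leNgt le_eqVlt (negPf (drawing_abb D _ yz)).
have lt0' x y z : y != z -> ~~ (0 < orient (b x) (a y) (a z)) ->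
    orient (b x) (a y) (a z) < 0.
  by move=> yz; rewrite -leNgt le_eqVlt (negPf (drawing_abb D' _ yz)).
(* The signs involving both ends of the non-edge [a i b i] come from [turn_matched]; those after
   them come directly from the orders. *)
have hu : 0 < orient (a i) (b i) (b l).
  by case: Sl => x [y [? ? ? ?]]; rewrite (@turn_matched _ _ _ _ i l x y D).
have hn : orient (a i) (b i) (b n) < 0.
  apply: lt0 => //; case: Sn => x [y [? ? ? ?]].
  by rewrite (@turn_matched _ _ _ _ i n x y D) // nsE.
have hm : orient (a i) (b i) (a m) < 0.
  have -> : orient (a i) (b i) (a m) = - orient (b i) (a i) (a m).
    exact: orient_swap.
  rewrite oppr_lt0; case: Sm => x [y [? ? ? ?]].
  by rewrite (@turn_matched _ _ _ _ i m x y D').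
have hv : 0 < orient (a i) (b i) (a k).
  have -> : orient (a i) (b i) (a k) = - orient (b i) (a i) (a k).
    exact: orient_swap.
  rewrite oppr_gt0; apply: lt0' => //; case: Sk => x [y [? ? ? ?]].
  by rewrite (@turn_matched _ _ _ _ i k x y D') // ntE.
have li : l != i by rewrite eq_sym.
have mi : m != i by rewrite eq_sym.
have lk : l != k by rewrite eq_sym.
have nm : n != m by rewrite eq_sym.
have ni2 (x y z : 'I_5) : x != y -> x != z -> x \notin [:: y; z].
  by move=> xy xz; rewrite !inE negb_or xy.
have pnu : 0 < orient (a i) (b n) (b l) by rewrite (turnE D) // ni2.
have qvm : 0 < orient (b i) (a k) (a m) by rewrite (turnE D') // ni2.
have rotab x y z : orient (a x) (b y) (a z) = orient (b y) (a z) (a x).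
  exact/esym/orient_rot.
have rotba x y z : orient (b x) (a y) (b z) = orient (a y) (b z) (b x).
  exact/esym/orient_rot.
(* With [hu] and [hv], this sign and the next make [a i b l] cross [b i a k]; the two after them
   make [a i b n] cross [b i a m]. *)
have puv : 0 < orient (a i) (b l) (a k).
  by rewrite rotab (turnE D' ki' (ni2 _ _ _ lk li)).
have qvu : orient (b i) (a k) (b l) < 0.
  by rewrite rotba (turnNE D li (ni2 _ _ _ kl ki')) (nsE i l il' il).
have qmn : 0 < orient (b i) (a m) (b n).
  by rewrite rotba (turnE D ni' (ni2 _ _ _ mn mi)).
have pnm : orient (a i) (b n) (a m) < 0.
  by rewrite rotab (turnNE D' mi (ni2 _ _ _ nm ni')) (ntE i m im' im).
have [p] := @fresh [:: i; l; n] isT.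
rewrite !inE !negb_or => /and3P[pi pl pn].
have ip : i != p by rewrite eq_sym.
have trap := wedge_trap (drawing_connected D) (drawing_edge D il')
  (drawing_edge D in') _ _ (drawing_ab D i) hu hv hn hm pnu qvm puv qvu qmn pnm.
have [z [Gz /segment_mem[t /andP[t0 t1] zE]]] := drawing_aa D ip.
have [||] := trap _ _ z Gz.
- by rewrite segmentC; apply: drawing_edge D _ _ _.
- by rewrite segmentC; apply: drawing_edge D _ _ _; rewrite eq_sym.
rewrite zE !orient_convex !orientxx !mulr0 !add0r => h1 h2.
have tp : 0 < t by rewrite lt_neqAle t0 andbT; apply: contraTneq h1 => <-; rewrite mul0r ltxx.
move: h1 h2; rewrite pmulr_rgt0 // pmulr_rlt0 //.
have E x : orient (a i) (b x) (a p) = - orient (b x) (a i) (a p).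
  exact: orient_swap.
rewrite !E oppr_gt0 oppr_lt0 => h1 h2.
have np : n != p by rewrite eq_sym.
have lp : l != p by rewrite eq_sym.
have E' := same_side D' ip (ni2 _ _ _ ni' np) (ni2 _ _ _ li lp).
by move: h1; rewrite ltNge ltW // E'.
Qed.

(** * From an obstacle representation to a drawing *)

Section LowerBound.
Variable R : realType.
Implicit Types (s : seq (plane R)).

Lemma connected_boundary s : connected (polygon_boundary s).
Proof.
rewrite /polygon_boundary; case: (size s) => [|n].
  by rewrite II0 bigcup_set0; exact: connected0.
elim: n => [|n IH].
  have -> : \bigcup_(i in `I_1) edge s i = edge s 0%N.
    rewrite eqEsubset; split=> [z [i /=]|z z0]; last by exists 0%N.
    by rewrite ltnS leqn0 => /eqP->.
  exact: connected_segment.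
have -> : \bigcup_(i in `I_n.+2) edge s i =
    \bigcup_(i in `I_n.+1) edge s i `|` edge s n.+1.
  rewrite eqEsubset; split=> z.
    case=> i /= ; rewrite ltnS leq_eqVlt => /orP[/eqP->|lt] iz; first by right.
    by left; exists i.
  by case=> [[i /= lt iz]|nz]; [exists i => //=; rewrite ltnW | exists n.+1 => /=].
apply: connectedU => //; last exact: connected_segment.
exists (vertex s n.+1); split; last exact: segment_left.
by exists n => //=; exact: segment_right.
Qed.

(** A segment missing the boundary stays in one component of its complement. *)
Lemma segment_meets_boundary s p q : ~ polygon_region s p ->
  segment p q `&` polygon_region s !=set0 ->
  polygon_boundary s `&` segment p q !=set0.
Proof.
move=> np [z [pqz rz]]; apply: contrapT => h; apply: np.
have sub : segment p q `<=` ~` polygon_boundary s.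
  by move=> w pw bw; apply: h; exists w.
case: rz => [bz|[nbz bdz]]; first by case: (sub _ pqz).
right; split; first by apply: sub; exact: segment_left.
rewrite (@same_connected_component _ _ p z) //.
apply: (connected_component_max (segment_left p q) sub) => //.
exact: connected_segment.
Qed.

End LowerBound.

(** Renumbering the second class by [g] makes matched vertices share an index. *)
Lemma matching_partner (M : rel ('I_5 + 'I_5)%type) :
  perfect_matching (complete_bipartite 5 5) M ->
  exists2 g : 'I_5 -> 'I_5, injective g & forall i j, M (inl i) (inr j) = (j == g i).
Proof.
case=> symM subM cardM.
have H i : {j | forall j', M (inl i) (inr j') = (j' == j)}.
  apply: cid; have [y yE] := @mem_card1 _ [pred y | M (inl i) y] (cardM _).
  have Miy : M (inl i) y by have := yE y; rewrite !inE eqxx.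
  case: y Miy yE => [y /subM //|j _ yE]; exists j => j'.
  by have := yE (inr j'); rewrite !inE.
exists (fun i => sval (H i)) => [i i' E|i j]; last by case: (H i).
have [y yE] := @mem_card1 _ [pred y | M (inr (sval (H i))) y] (cardM _).
have E1 : inl i \in [pred y | M (inr (sval (H i))) y].
  by rewrite inE symM; case: (H i) => j /= ->.
have E2 : inl i' \in [pred y | M (inr (sval (H i))) y].
  by rewrite inE symM E; case: (H i') => j /= ->.
by move: E1 E2; rewrite !yE !inE => /eqP<- /eqP[].
Qed.

Lemma remove_edges_inl_inr (M : rel ('I_5 + 'I_5)%type) (g : 'I_5 -> 'I_5) :
  injective g -> (forall i j, M (inl i) (inr j) = (j == g i)) ->
  forall i j,
    remove_edges (complete_bipartite 5 5) M (inl i) (inr (g j)) = (i != j).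
Proof.
by move=> ginj gE i j; rewrite /remove_edges /= gE (inj_eq ginj) eq_sym.
Qed.

Lemma obstacle_number_ge2 (R : realType) (M : rel ('I_5 + 'I_5)%type) k :
  perfect_matching (complete_bipartite 5 5) M ->
  has_obstacle_representation R (remove_edges (complete_bipartite 5 5) M) k ->
  (2 <= k)%N.
Proof.
move=> hM [P [Ob [[_ Obs _ PO gp] [f fbij fe]]]]; case: fbij => fP finj _.
have {}finj : injective f by move=> u v; apply: finj; rewrite inE.
have {}fP u : P (f u) by apply: fP.
have nvis u v : u != v -> ~~ remove_edges (complete_bipartite 5 5) M u v ->
    exists i, segment (f u) (f v) `&` polygon_region (Ob i) !=set0.
  move=> uv nuv; apply: contrapT => h; apply: (negP nuv); apply/fe.
  split=> //; first by move=> /finj/eqP; rewrite (negPf uv).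
  move=> i; apply: contrapT => hi; apply: h; exists i.
  by apply/set0P/eqP.
(* Without obstacles nothing blocks a non-edge; a single obstacle gives a [drawing]. *)
case: k Ob Obs PO gp fe nvis => [|[|k]] // Ob Obs PO gp fe nvis.
  by have [[]] := nvis (inl ord0) (inl ord_max) isT isT.
exfalso; have [g ginj gE] := matching_partner hM.
have eE := remove_edges_inl_inr ginj gE.
pose G := polygon_boundary (Ob ord0).
have meets u v : u != v -> ~~ remove_edges (complete_bipartite 5 5) M u v ->
    G `&` segment (f u) (f v) !=set0.
  move=> uv /(nvis _ _ uv)[i]; rewrite (ord1 i) => h.
  apply: segment_meets_boundary h => r.
  by have : (P `&` polygon_region (Ob ord0)) (f u) by []; rewrite PO.
have gpn u v w : u != v -> u != w -> v != w -> orient (f u) (f v) (f w) != 0.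
  move=> uv uw vw; apply: orient_neq0; apply: gp; try (by left);
  by move=> /finj/eqP; apply/negP.
apply: (@no_drawing R (fun i => f (inl i)) (fun i => f (inr (g i))) G).
split=> [|i j k ij|i j k jk|i j ij|i j ij|i j ij|i].
- exact: connected_boundary.
- by apply: gpn.
- by apply: gpn => //; apply: contraNneq jk => -[/ginj->].
- have : remove_edges (complete_bipartite 5 5) M (inl i) (inr (g j)) by rewrite eE.
  move=> /fe[_ _ _ /(_ ord0)] E; rewrite -subset0 => z [Gz sz].
  by rewrite -E; split=> //; left.
- exact: meets.
- by apply: meets => //; apply: contraNneq ij => -[/ginj->].
- by apply: meets => //; rewrite eE eqxx.
Qed.

(** * Sign tests for segments and criteria for lying outside a polygon *)

Section SegmentTests.
Variable R : realType.
Implicit Types (p q r x y z : plane R) (s : seq (plane R)).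

Lemma segments_disjoint p q x y : 0 < orient p q x * orient p q y ->
  segment p q `&` segment x y = set0.
Proof.
move=> h; rewrite -subset0 => z [/segment_mem[t _ zE] /segment_mem[u /andP[u0 u1] zE']].
have : orient p q z = 0 by rewrite zE orient_convex orientxx orientpp !mulr0 addr0.
rewrite zE' orient_convex => E.
set A := orient p q x in h E; set B := orient p q y in h E.
have [u1'|u1'] := eqVneq u 1.
  move: E; rewrite u1' subrr mul0r mul1r add0r => B0.
  by move: h; rewrite B0 mulr0 ltxx.
have up : 0 < 1 - u by rewrite subr_gt0 lt_neqAle u1'.
have S : A * ((1 - u) * A + u * B) = 0 by rewrite E mulr0.
have A0 : A != 0 by apply: contraTneq h => ->; rewrite mul0r ltxx.
have A2 : 0 < A ^+ 2 by rewrite exprn_even_gt0.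
have := mulr_gt0 up A2; have := mulr_ge0 u0 (ltW h).
move: S; rewrite expr2 => S P1 P2.
have S' : (1 - u) * (A * A) + u * (A * B) = 0 by rewrite -S; ring.
by move: (ltr_wpDr P1 P2); rewrite S' ltxx.
Qed.

Lemma crossing_param p q x y : orient p q x * orient p q y < 0 ->
  exists2 t, 0 <= t <= 1 & orient p q ((1 - t) *: x + t *: y) = 0.
Proof.
set A := orient p q x; set B := orient p q y => h.
have AB : A - B != 0.
  by rewrite subr_eq0; apply: contraTneq h => ->; rewrite -expr2 -leNgt sqr_ge0.
exists (A / (A - B)); last first.
  by rewrite orient_convex -/A -/B; field.
have [A0|A0|A0] := ltgtP A 0; last by move: h; rewrite A0 mul0r ltxx.
- have B0 : 0 < B by rewrite -(nmulr_rlt0 _ A0).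
  rewrite -mulrNN -invrN divr_ge0 /=; try lra.
  by rewrite ler_pdivrMr; lra.
- have B0 : B < 0 by rewrite -(pmulr_rlt0 _ A0).
  by rewrite divr_ge0 /= ?ler_pdivrMr; lra.
Qed.

Lemma segments_cross p q x y : orient p q x * orient p q y < 0 ->
  orient x y p * orient x y q < 0 -> segment p q `&` segment x y !=set0.
Proof.
move=> h1 h2; have [t t01 tE] := crossing_param h1.
have [u u01 uE] := crossing_param h2.
have xq : orient p q x != 0 by apply: contraTneq h1 => ->; rewrite mul0r ltxx.
set z := (1 - t) *: x + t *: y in tE; exists z; split; last exact: segmentP.
have /= := line_param xq tE; set v := _ / _ => zE.
rewrite zE; apply: segmentP.
have E2 : orient x y z = 0.
  by rewrite orient_convex orientxx orientpp !mulr0 addr0.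
move: E2 uE; rewrite zE !orient_convex.
set A := orient x y p in h2 *; set B := orient x y q in h2 * => E1 E2.
have AB : A - B != 0.
  by rewrite subr_eq0; apply: contraTneq h2 => ->; rewrite -expr2 -leNgt sqr_ge0.
suff -> : v = u by [].
apply: (mulIf AB); apply/eqP; rewrite -subr_eq0; apply/eqP.
transitivity (((1 - u) * A + u * B) - ((1 - v) * A + v * B)); first by ring.
by rewrite E1 E2 subrr.
Qed.

Lemma adjacent_segments p q r : orient p q r != 0 ->
  segment p q `&` segment q r `<=` [set q].
Proof.
move=> D0 z [/segment_mem[t _ zE] /segment_mem[u _ zE']] /=.
have : orient p q z = 0 by rewrite zE orient_convex orientxx orientpp !mulr0 addr0.
rewrite zE' orient_convex orientpp mulr0 add0r => /eqP.
by rewrite mulf_eq0 (negPf D0) orbF => /eqP->; rewrite subr0 scale1r scale0r addr0.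
Qed.

(** A horizontal ray from [x] misses the boundary, so the component of [x] is unbounded. The sign of
    [e] selects a lower or an upper half-plane. *)
Lemma halfplane_outside (e c : R) s x : (forall v, v \in s -> c < e * v.2) ->
  e * x.2 <= c -> (0 < size s)%N -> ~ polygon_region s x.
Proof.
move=> hs hx s0.
have vs i : c < e * (vertex s i).2 by apply: hs; rewrite mem_nth // ltn_pmod.
have nb z : e * z.2 <= c -> ~ polygon_boundary s z.
  move=> hz [i _ /segment_mem[t /andP[t0 t1] zE]].
  have hv := vs i; have hw := vs i.+1.
  set A := e * _ in hv; set B := e * _ in hw.
  have zAB : e * z.2 = (1 - t) * A + t * B.
    by rewrite zE /A /B /= /GRing.scale /=; ring.
  move: hz; rewrite leNgt zAB => /negP; apply.
  by clear -hv hw t0 t1; have [AB|AB] := leP A B; nra.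
case=> [/(nb x hx)//|[_ bd]].
have [N N0 hN] := pinfty_ex_gt0 bd.
(* The first coordinate of [y] exceeds [N] whatever the sign of [x.1]. *)
pose y : plane R := (x.1 + (N + 1 + `|x.1|), x.2).
have : connected_component (~` polygon_boundary s) x y.
  apply: (@connected_component_max _ _ (segment x y)).
  - exact: segment_left.
  - move=> z /segment_mem[t _ zE]; apply: nb.
    suff -> : z.2 = x.2 by [].
    by rewrite zE /= /GRing.scale /=; ring.
  - exact: connected_segment.
  - exact: segment_right.
move=> /hN /=; rewrite prod_normE ge_max => /andP[+ _] /=.
have := ler_norm (x.1 + (N + 1 + `|x.1|)); have := ler_norm (- x.1).
rewrite normrN; lra.
Qed.

Lemma outside_segment s p q : ~ polygon_region s p ->
  segment p q `&` polygon_boundary s = set0 ->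
  segment p q `&` polygon_region s = set0.
Proof.
move=> np E; apply: contrapT => /eqP/set0P h.
by have [z [bz pz]] := segment_meets_boundary np h; rewrite -[False]/(set0 z) -E.
Qed.

Lemma outside_edge s p q : ~ polygon_region s p ->
  segment p q `&` polygon_boundary s = set0 -> ~ polygon_region s q.
Proof.
move=> np E rq; have := outside_segment np E.
by rewrite -subset0 => /(_ q); apply; split=> //; exact: segment_right.
Qed.

End SegmentTests.

(** * Computable tests for points with integer coordinates *)

Section IntegerPoints.
Variable R : realType.
Local Open Scope Z_scope.
Implicit Types (p q x y : Z * Z) (s : seq (Z * Z)).

Definition zreal (z : Z) : R := (int_of_Z z)%:~R.

Lemma zrealB (u v : Z) : zreal (u - v) = (zreal u - zreal v)%R.
Proof. by rewrite /zreal -rmorphB -rmorphB. Qed.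

Lemma zrealM (u v : Z) : zreal (u * v) = (zreal u * zreal v)%R.
Proof. by rewrite /zreal -rmorphM -rmorphM. Qed.

Lemma zreal_gt0 (z : Z) : (0 < zreal z)%R = (0 <? z).
Proof.
rewrite /zreal ltr0z; case: z => [|p|p] //=.
by rewrite ltz_nat; apply/ssrnat.ltP; exact: Pos2Nat.is_pos.
Qed.

Lemma zreal_lt (u v : Z) : (zreal u < zreal v)%R = (u <? v).
Proof. by rewrite -subr_gt0 -zrealB zreal_gt0; apply/idP/idP; lia. Qed.

Lemma zreal_inj : injective zreal.
Proof.
move=> u v E; have := zreal_lt u v; have := zreal_lt v u.
by rewrite E ltxx; lia.
Qed.

Definition embed p : plane R := (zreal p.1, zreal p.2).

Lemma embed_inj : injective embed.
Proof. by case=> [x1 x2] [y1 y2] [/zreal_inj-> /zreal_inj->]. Qed.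

Definition zorient p q x : Z :=
  (q.1 - p.1) * (x.2 - p.2) - (x.1 - p.1) * (q.2 - p.2).

Lemma orient_embed p q x :
  orient (embed p) (embed q) (embed x) = zreal (zorient p q x).
Proof. by rewrite /zorient zrealB !zrealM !zrealB. Qed.

Lemma orient_embed_neq0 p q x : zorient p q x != 0 ->
  orient (embed p) (embed q) (embed x) != 0%R.
Proof.
apply: contra; rewrite orient_embed => /eqP E; apply/eqP/zreal_inj; exact: E.
Qed.

(** A sufficient test: one segment lies strictly on one side of the other's line. *)
Definition zdisjoint p q x y : bool :=
  (0 <? zorient p q x * zorient p q y) || (0 <? zorient x y p * zorient x y q).

Lemma zdisjointP p q x y : zdisjoint p q x y ->
  segment (embed p) (embed q) `&` segment (embed x) (embed y) = set0.
Proof.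
case/orP => h; last rewrite setIC; apply: segments_disjoint;
  by rewrite !orient_embed -zrealM zreal_gt0.
Qed.

Definition zcross p q x y : bool :=
  (zorient p q x * zorient p q y <? 0) && (zorient x y p * zorient x y q <? 0).

Lemma zcrossP p q x y : zcross p q x y ->
  segment (embed p) (embed q) `&` segment (embed x) (embed y) !=set0.
Proof.
by case/andP => h1 h2; apply: segments_cross;
  rewrite !orient_embed -zrealM -[0%R]/(zreal 0) zreal_lt.
Qed.

Definition zvertex s (i : nat) : Z * Z := nth (0, 0) s (i %% size s).

Lemma vertex_embed s i : (0 < size s)%N ->
  vertex (map embed s) i = embed (zvertex s i).
Proof.
by move=> s0; rewrite /vertex (nth_map (0, 0)) size_map // ltn_pmod.
Qed.

Definition zavoids p q s : bool :=
  all (fun i => zdisjoint p q (zvertex s i) (zvertex s i.+1)) (iota 0 (size s)).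

Lemma zavoidsP p q s : zavoids p q s ->
  segment (embed p) (embed q) `&` polygon_boundary (map embed s) = set0.
Proof.
move=> /allP h; rewrite -subset0 => z [pqz [i /=]]; rewrite size_map => i_s.
have s0 : (0 < size s)%N by apply: leq_ltn_trans i_s.
rewrite /edge !vertex_embed // => iz.
have := h i; rewrite mem_iota => /(_ i_s)/zdisjointP.
by rewrite -subset0 => /(_ z); apply.
Qed.

Definition zmeets p q s : bool :=
  has (fun i => zcross p q (zvertex s i) (zvertex s i.+1)) (iota 0 (size s)).

Lemma zmeetsP p q s : zmeets p q s ->
  segment (embed p) (embed q) `&` polygon_boundary (map embed s) !=set0.
Proof.
move=> /hasP[i]; rewrite mem_iota /= => i_s /zcrossP[z [pqz iz]]; exists z.
have s0 : (0 < size s)%N by apply: leq_ltn_trans i_s.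
by split=> //; exists i; rewrite /= ?size_map // /edge !vertex_embed.
Qed.

(** Consecutive edges share a vertex and fail [zdisjoint]; for them non-collinearity suffices. *)
Definition zsimple s : bool :=
  [&& (3 <= size s)%N, uniq s &
  all (fun i => all (fun j =>
    if i == j then true
    else if (i.+1 %% size s)%N == j then
      zorient (zvertex s i) (zvertex s j) (zvertex s j.+1) != 0
    else if (j.+1 %% size s)%N == i then
      zorient (zvertex s j) (zvertex s i) (zvertex s i.+1) != 0
    else zdisjoint (zvertex s i) (zvertex s i.+1) (zvertex s j) (zvertex s j.+1))
  (iota 0 (size s))) (iota 0 (size s))].

Lemma zsimpleP s : zsimple s -> simple_polygon (map embed s).
Proof.
move=> /and3P[s3 us /allP h]; split; rewrite ?size_map ?(map_inj_uniq embed_inj) //.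
move=> i j i_s j_s /eqP ij.
have s0 : (0 < size s)%N by apply: leq_ltn_trans i_s.
have := h i; rewrite mem_iota => /(_ i_s)/allP/(_ j).
rewrite mem_iota => /(_ j_s); rewrite (negPf ij) /edge !vertex_embed //.
have vS k m : (k.+1 %% size s)%N = m -> (m < size s)%N -> zvertex s k.+1 = zvertex s m.
  by move=> E m_s; rewrite /zvertex E modn_small.
have [/vS /(_ j_s)->|_] := eqVneq (i.+1 %% size s)%N j.
  move=> /orient_embed_neq0 /adjacent_segments sub z /sub /= ->.
  by split; [right | left].
have [/vS /(_ i_s)->|_] := eqVneq (j.+1 %% size s)%N i.
  move=> /orient_embed_neq0 /adjacent_segments sub z.
  by rewrite setIC => /sub /= ->; split; [left | right].
by move=> /zdisjointP ->; exact: sub0set.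
Qed.

Fixpoint zgeneral_from p s : bool :=
  if s is q :: s' then all (fun x => zorient p q x != 0) s' && zgeneral_from p s'
  else true.

Fixpoint zgeneral s : bool :=
  if s is p :: s' then zgeneral_from p s' && zgeneral s' else true.

Lemma zorientC p q x : zorient p x q = - zorient p q x.
Proof. by rewrite /zorient; case: p q x => [? ?] [? ?] [? ?] /=; lia. Qed.

Lemma zorient_rot p q x : zorient q x p = zorient p q x.
Proof. by rewrite /zorient; case: p q x => [? ?] [? ?] [? ?] /=; lia. Qed.

Lemma zorientC_neq0 p q x : zorient p q x != 0 -> zorient p x q != 0.
Proof. by rewrite zorientC; apply: contra => /eqP E; apply/eqP; lia. Qed.

Lemma zgeneral_fromP p q x s : zgeneral_from p s ->
  q \in s -> x \in s -> q != x -> zorient p q x != 0.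
Proof.
elim: s => // y s IH /= /andP[/allP h gs].
rewrite !inE => /orP[/eqP->|qs] /orP[/eqP->|xs] qx.
- by rewrite eqxx in qx.
- exact: h.
- by apply: zorientC_neq0; apply: h.
- exact: IH.
Qed.

(** The test visits each unordered triple once; antisymmetry of [zorient] gives the other orders. *)
Lemma zgeneralP s : zgeneral s -> forall p q x, p \in s -> q \in s -> x \in s ->
  p != q -> p != x -> q != x -> zorient p q x != 0.
Proof.
elim: s => // y s IH /= /andP[h gs] p q x.
rewrite !inE => /orP[/eqP->|ps] /orP[/eqP->|qs] /orP[/eqP->|xs] pq px qx;
  rewrite ?eqxx // in pq px qx *.
- exact: zgeneral_fromP h _ _ _.
- by rewrite zorientC_neq0 // zorient_rot; apply: zgeneral_fromP h _ _ _.
- by rewrite -zorient_rot -zorient_rot; apply: zgeneral_fromP h _ _ _.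
- exact: IH.
Qed.

End IntegerPoints.

(** * The explicit drawing and its verification *)

Section Construction.
Local Open Scope Z_scope.

(* The two colour classes lie near two vertical lines; from top to bottom     *)
(* their indices are 0, 2, 4, 3, 1 and 2, 0, 4, 1, 3, so that 4 is the only   *)
(* index that is extreme in neither order.                                    *)
Definition left_points : seq (Z * Z) :=
  [:: (0, 161); (-1, -9); (1, 120); (-1, 40); (1, 79)].

Definition right_points : seq (Z * Z) :=
  [:: (400, 119); (399, 41); (400, 161); (399, -1); (401, 80)].

(* A frame around the drawing, open at the bottom, with a tooth entering each *)
(* gap between consecutive points of the same colour.                         *)
Definition outer_obstacle : seq (Z * Z) :=
  [:: (-39, 173); (48, 121); (-41, 121); (40, 100); (-39, 81); (41, 59);
      (-40, 39); (47, 37); (-81, 21); (-81, 239); (480, 240); (480, 19);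
      (353, 37); (440, 41); (359, 60); (441, 80); (360, 101); (439, 120);
      (352, 123); (439, 172)].

(* Placed on the segment between the two points of index 4, which the outer   *)
(* obstacle cannot reach.                                                     *)
Definition inner_obstacle : seq (Z * Z) := [:: (80, 86); (84, 74); (104, 81)].

Definition left_point i := nth (0, 0) left_points i.
Definition right_point i := nth (0, 0) right_points i.

Lemma construction_general :
  zgeneral (left_points ++ right_points ++ outer_obstacle ++ inner_obstacle).
Proof. by vm_compute. Qed.

Lemma construction_uniq : uniq (left_points ++ right_points).
Proof. by vm_compute. Qed.

Lemma construction_simple : zsimple outer_obstacle && zsimple inner_obstacle.
Proof. by vm_compute. Qed.

Lemma construction_edges :
  all (fun i => all (fun j => (i == j) ||
    zavoids (left_point i) (right_point j) outer_obstacle &&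
    zavoids (left_point i) (right_point j) inner_obstacle)
  (iota 0 5)) (iota 0 5).
Proof. by vm_compute. Qed.

Lemma construction_nonedges :
  all (fun i => all (fun j => (i == j) ||
    zmeets (left_point i) (left_point j) outer_obstacle &&
    zmeets (right_point i) (right_point j) outer_obstacle)
  (iota 0 5)) (iota 0 5).
Proof. by vm_compute. Qed.

Lemma construction_matched :
  all (fun i => zmeets (left_point i) (right_point i) outer_obstacle ||
    zmeets (left_point i) (right_point i) inner_obstacle) (iota 0 5).
Proof. by vm_compute. Qed.

(** This point of the graph is below both obstacles; from it, being outside spreads along the
    edges. *)
Lemma construction_low :
  all (fun v => (left_point 1).2 <? v.2) (outer_obstacle ++ inner_obstacle).
Proof. by vm_compute. Qed.

(** A vertex of the outer obstacle above the inner one tells the two regions apart. *)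
Lemma construction_high :
  all (fun v => v.2 <? (nth (0, 0) outer_obstacle 9).2) inner_obstacle.
Proof. by vm_compute. Qed.

End Construction.

(** * The upper bound *)

Lemma two_obstacles (R : realType) (M : rel ('I_5 + 'I_5)%type) :
  perfect_matching (complete_bipartite 5 5) M ->
  has_obstacle_representation R (remove_edges (complete_bipartite 5 5) M) 2.
Proof.
move=> hM; have [g ginj gE] := matching_partner hM.
have symM : symmetric M by case: hM.
have [h hK gK] := injF_bij ginj.
have eE := remove_edges_inl_inr ginj gE.
pose emb := @embed R.
pose A (i : 'I_5) := emb (left_point i); pose B (i : 'I_5) := emb (right_point i).
(* The inverse [h] of [g] places matched vertices at equal positions of the two lists. *)
pose f (u : ('I_5 + 'I_5)%type) :=
  match u with inl i => A i | inr j => B (h j) end.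
pose Ob (o : 'I_2) := map emb (if o == ord0 then outer_obstacle else inner_obstacle).
have in5 (i : 'I_5) : (i : nat) \in iota 0 5 by rewrite mem_iota ltn_ord.
have zu := construction_uniq.
have mL (i : 'I_5) : left_point i \in left_points by rewrite mem_nth // ltn_ord.
have mR (i : 'I_5) : right_point i \in right_points by rewrite mem_nth // ltn_ord.
have Ainj : injective A.
  move=> i j /embed_inj E; apply/val_inj/eqP.
  move: zu; rewrite cat_uniq => /and3P[ul _ _].
  by rewrite -(nth_uniq (Z0, Z0) _ _ ul) ?ltn_ord //; apply/eqP.
have Binj : injective B.
  move=> i j /embed_inj E; apply/val_inj/eqP.
  move: zu; rewrite cat_uniq => /and3P[_ _ ur].
  by rewrite -(nth_uniq (Z0, Z0) _ _ ur) ?ltn_ord //; apply/eqP.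
have AB i j : A i <> B j.
  move=> /embed_inj E; move: zu; rewrite cat_uniq => /and3P[_ /hasP + _].
  by apply; exists (right_point j); rewrite // -E /=.
have finj : injective f.
  move=> [i|i] [j|j] /= E; first by rewrite (Ainj _ _ E).
  - by case: (AB _ _ E).
  - by case: (AB _ _ (esym E)).
  - by have /(can_inj gK)-> := Binj _ _ E.
have edge_avoid (i j : 'I_5) (o : 'I_2) : i != j ->
    segment (A i) (B j) `&` polygon_boundary (Ob o) = set0.
  move=> ij; have /allP/(_ i (in5 i))/allP/(_ j (in5 j)) := construction_edges.
  rewrite (_ : (i == j :> nat) = false) /=; last exact/negbTE.
  by case/andP=> h1 h2; rewrite /Ob; case: ifP => _; apply: zavoidsP.
have start (o : 'I_2) : ~ polygon_region (Ob o) (A (@Ordinal 5 1 isT)).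
  apply: (@halfplane_outside _ 1 (zreal R (left_point 1).2)).
  - move=> v /mapP[w hw ->]; rewrite mul1r /= zreal_lt.
    have /allP := construction_low; apply; rewrite mem_cat.
    by move: hw; case: ifP => _ ->; rewrite ?orbT.
  - by rewrite mul1r.
  - by rewrite size_map; case: ifP.
have AtoB i j o : i != j -> ~ polygon_region (Ob o) (A i) ->
    ~ polygon_region (Ob o) (B j).
  by move=> ij nA; apply: outside_edge nA _; apply: edge_avoid.
have BtoA i j o : i != j -> ~ polygon_region (Ob o) (B j) ->
    ~ polygon_region (Ob o) (A i).
  by move=> ij nB; apply: outside_edge nB _; rewrite segmentC; apply: edge_avoid.
(* Two edges lead from the lowest point to [A i], through [B j] for any [j] other than [i] and 1. *)
have Aout i o : ~ polygon_region (Ob o) (A i).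
  have [j] := @fresh [:: i; @Ordinal 5 1 isT] isT.
  rewrite !inE !negb_or => /andP[ji j1].
  by apply: (@BtoA i j); rewrite 1?eq_sym //; apply: AtoB (start o); rewrite eq_sym.
have Bout i o : ~ polygon_region (Ob o) (B i).
  have [j] := @fresh [:: i] isT; rewrite !inE => ji.
  exact: AtoB ji (Aout j o).
have fout u o : ~ polygon_region (Ob o) (f u).
  by case: u => i; [exact: Aout | exact: Bout].
have sub_region o : polygon_boundary (Ob o) `<=` polygon_region (Ob o).
  by move=> z; left.
exists (range f), Ob; split.
  split.
  - exact: finite_image.
  - move=> o; have /andP[s1 s2] := construction_simple.
    by rewrite /Ob; case: ifP => _; apply: zsimpleP.
  - have top : polygon_region (map emb outer_obstacle)
        (emb (nth (Z0, Z0) outer_obstacle 9)).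
      left; exists 9%N => //.
      by have := segment_left (vertex (map emb outer_obstacle) 9)
        (vertex (map emb outer_obstacle) 10).
    have ntop : ~ polygon_region (map emb inner_obstacle)
        (emb (nth (Z0, Z0) outer_obstacle 9)).
      apply: (@halfplane_outside _ (- 1) (- zreal R (nth (Z0, Z0) outer_obstacle 9).2)).
      + move=> v /mapP[w hw ->]; rewrite mulN1r ltrN2 /= zreal_lt.
        by have /allP := construction_high; apply.
      + by rewrite mulN1r.
      + by rewrite size_map.
    move=> o o'; rewrite /Ob; case: eqVneq => [->|o0]; case: eqVneq => [->|o0'] // E.
    + by case: ntop; rewrite -E.
    + by case: ntop; rewrite E.
    + move: o o' o0 o0' {E} => [[|[|o]] ho] [[|[|o']] ho'] //= _ _.
      exact: val_inj.
  - move=> o; rewrite -subset0 => z [[u _ <-]]; exact: fout.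
  - have memL x : (range f `|` \bigcup_o [set` Ob o]) x ->
        exists2 w, w \in left_points ++ right_points ++ outer_obstacle ++ inner_obstacle
          & x = emb w.
      case=> [[[i|i] _ <-]|[ o _ /mapP[w hw ->]]].
      + by exists (left_point i) => //; rewrite mem_cat mL.
      + by exists (right_point (h i)) => //; rewrite !mem_cat mR orbT.
      + exists w => //; rewrite !mem_cat.
        by move: hw; case: ifP => _ ->; rewrite ?orbT.
    move=> p q r /memL[p' hp ->] /memL[q' hq ->] /memL[r' hr ->] pq pr qr col.
    have neq x y : emb x <> emb y -> x != y by move=> xy; apply/eqP => E; apply: xy; rewrite E.
    have := zgeneralP construction_general hp hq hr (neq _ _ pq) (neq _ _ pr) (neq _ _ qr).
    by move=> /(@orient_embed_neq0 R) /eqP; apply; rewrite /orient col subrr.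
exists f.
  by split=> [u _|u v _ _|p [u _ <-]]; [exists u | exact: finj | exists u].
have vis i j : i != j -> visibility (range f) Ob (A i) (B j).
  move=> ij; split; [by exists (inl i) | by exists (inr (g j)); rewrite //= hK | exact: AB |].
  by move=> o; apply: outside_segment; [exact: Aout | exact: edge_avoid].
have blocked p q o : segment p q `&` polygon_boundary (Ob o) !=set0 ->
    ~ visibility (range f) Ob p q.
  move=> [z [pz bz]] [_ _ _ /(_ o)]; rewrite -subset0 => /(_ z); apply.
  by split=> //; apply: sub_region.
have visC p q : visibility (range f) Ob p q -> visibility (range f) Ob q p.
  by move=> [Pp Pq pq H]; split=> // [/esym //|o]; rewrite segmentC.
have eC u v : remove_edges (complete_bipartite 5 5) M u v =
    remove_edges (complete_bipartite 5 5) M v u.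
  by rewrite /remove_edges symM; congr (_ && _); case: u; case: v.
have cross i j : remove_edges (complete_bipartite 5 5) M (inl i) (inr j) <->
    visibility (range f) Ob (A i) (B (h j)).
  rewrite -{1}(gK j) eE; split; first exact: vis.
  move=> v; apply: contraPT v; rewrite negbK => /eqP <-.
  have /allP/(_ i (in5 i))/orP[] := construction_matched => /(@zmeetsP R) m.
    exact: (@blocked _ _ ord0).
  exact: (@blocked _ _ ord_max).
move=> [i|i] [j|j].
- split=> // v; exfalso; have [ij|ij] := eqVneq i j.
    by case: v => _ _; rewrite ij.
  have /allP/(_ i (in5 i))/allP/(_ j (in5 j)) := construction_nonedges.
  rewrite (_ : (i == j :> nat) = false) /=; last exact/negbTE.
  by case/andP=> /(@zmeetsP R) m _; apply: (@blocked _ _ ord0) v.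
- exact: cross.
- by rewrite eC; split=> [/cross/visC|/visC/cross].
- split=> // v; exfalso; have [ij|ij] := eqVneq i j.
    by case: v => _ _; rewrite ij.
  have hij : h i != h j by rewrite (can_eq gK).
  have /allP/(_ _ (in5 (h i)))/allP/(_ _ (in5 (h j))) := construction_nonedges.
  rewrite (_ : (h i == h j :> nat) = false) /=; last exact/negbTE.
  by case/andP=> _ /(@zmeetsP R) m; apply: (@blocked _ _ ord0) v.
Qed.

Theorem theorem1 (R : realType) (M : rel ('I_5 + 'I_5)%type)
    (hM : perfect_matching (complete_bipartite 5 5) M) :
  is_obstacle_number R (remove_edges (complete_bipartite 5 5) M) 2.
Proof.
by split=> [|k]; [exact: two_obstacles | exact: obstacle_number_ge2].
Qed.
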